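(* Suppose $f_{\min}>-\infty$ and $d=\deg f\ge1$. Suppose $K$ is closed at $\infty$, $\mathcal E=\{1,\dots,m_1\}$, $\mathcal I=\{m_1+1,\dots,m_2\}$ and $m_1\le n-1$. If the polynomials $f\in\mathbb R[x]_{d_0}$ and $c_i\in\mathbb R[x]_{d_i}$ ($i\in\mathcal E\cup\mathcal I$) satisfy the conditions: (i) for all $m_1+1\le j_1<\cdots<j_{n-m_1}\le m_2$, $$\operatorname{Res}\big(c_1^{(1)},\dots,c_{m_1}^{(1)},c_{j_1}^{(1)},\dots,c_{j_{n-m_1}}^{(1)}\big)\neq0;$$ (ii) for all $m_1+1\le j_1<\cdots<j_r\le m_2$ with $0\le r\le n-m_1-1$, $$\Delta\big(f^{(1)},c_1^{(1)},\dots,c_{m_1}^{(1)},c_{j_1}^{(1)},\dots,c_{j_r}^{(1)}\big)\neq0,$$ then (P) has no minimizers at infinity.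
   Context: **Problem.** $\mathcal E,\mathcal I$ are disjoint finite label sets; $f,c_i\ (i\in\mathcal E\cup\mathcal I)$ are real polynomials in $x=(x_1,\dots,x_n)$; $\mathbb R[x]_k$ is the set of polynomials of degree $\le k$. Problem (P): minimize $f(x)$ subject to $c_i(x)=0\ (i\in\mathcal E)$, $c_j(x)\ge 0\ (j\in\mathcal I)$. $K$ is its feasible set and $f_{\min}=\inf_K f$. For a polynomial $p$, $p^{(1)}$ is its homogeneous part of highest degree. **Homogenization.** $\tilde x=(x_0,x)\in\mathbb R^{n+1}$; $\tilde p(\tilde x)=x_0^{\deg p}p(x/x_0)$. Let $\widetilde K^h=\{\tilde x:\tilde c_i(\tilde x)=0\,(i\in\mathcal E),\ \tilde c_j(\tilde x)\ge0\,(j\in\mathcal I),\ x_0\ge0\}$, $\widetilde K^c=\widetilde K^h\cap\{x_0>0\}$, $\widetilde K=\widetilde K^h\cap\{\|\tilde x\|^2=1\}$. $K$ (with its given description) is closed at $\infty$ if the closure of $\widetilde K^c$ equals $\widetilde K^h$. A point $x^*\in\mathbb R^n$ is a minimizer at infinity of (P) if $\tilde x^*=(0,x^* )\in\widetilde K$ and $\tilde f(\tilde x^* )-f_{\min}\cdot(\tilde x_0^* )^d=0$. **Resultants and discriminants.** For forms $p_1,\dots,p_n$ in $x=(x_1,\dots,x_n)$, $\operatorname{Res}(p_1,\dots,p_n)$ is a polynomial in the coefficients of the $p_i$ with: $\operatorname{Res}(p_1,\dots,p_n)=0$ if and only if there is $0\ne u\in\mathbb C^n$ with $p_1(u)=\cdots=p_n(u)=0$.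 For $m\le n$ forms, $\Delta(p_1,\dots,p_m)$ is a polynomial in the coefficients with: $\Delta(p_1,\dots,p_m)=0$ if and only if there is $0\neq u\in\mathbb C^n$ with $p_1(u)=\cdots=p_m(u)=0$ and $\operatorname{rank}[\nabla p_1(u)\ \cdots\ \nabla p_m(u)]<m$. Thus the conditions $\operatorname{Res}\ne0$, $\Delta\neq0$ mean that no such $u$ exists. *)

(* Defs.v *)
(* mpoly and complex have to be imported before the mathcomp-analysis files:
   in the other order the notations of mpoly are rejected. *)
From HB Require Import structures.
From mathcomp Require Import all_boot all_order all_algebra.
From mathcomp Require Import complex mpoly.
From mathcomp Require Import boolp classical_sets reals constructive_ereal.
From mathcomp Require Import ereal topology normedtype.

Set Implicit Arguments.
Unset Strict Implicit.
Unset Printing Implicit Defensive.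

Import Order.TTheory GRing.Theory Num.Theory.
Import numFieldNormedType.Exports.

Local Open Scope classical_set_scope.
Local Open Scope ring_scope.

(* [p.@[x 0]] is the value of p at the row vector x, since [x 0 i] is the
   i-th coordinate of x. *)

Section Homogenization.
Variables (R : realType) (n : nat).
Implicit Types (p : {mpoly R[n]}) (m : 'X_{1..n}).

(* The zero polynomial gets degree 0. *)
Definition mpdeg p : nat := (msize p).-1.

(* p^(1), the homogeneous part of degree deg p *)
Definition topform p : {mpoly R[n]} := pihomog mdeg (mpdeg p) p.

(* In R^(n+1) the homogenizing variable x_0 has index ord0, and x_(i+1) in the
   new numbering is the old variable of index i. *)
Definition homog_mnm (d : nat) m : 'X_{1..n.+1} :=
  [multinom oapp m (d - mdeg m)%N (unlift ord0 i) | i < n.+1].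

Definition homogenize p : {mpoly R[n.+1]} :=
  \sum_(m <- msupp p) p@_m *: 'X_[homog_mnm (mpdeg p) m].

(* (x_0, x) *)
Definition hpoint (x0 : R) (x : 'rV[R]_n) : 'rV[R]_n.+1 :=
  row_mx (x0%:M : 'M_1) x.

Lemma hpoint0 (x0 : R) (x : 'rV[R]_n) : hpoint x0 x 0 ord0 = x0.
Proof.
have -> : ord0 = lshift n (ord0 : 'I_1) by apply: val_inj.
by rewrite [LHS]row_mxEl mxE eqxx.
Qed.

Lemma hpointS (x0 : R) (x : 'rV[R]_n) (i : 'I_n) :
  hpoint x0 x 0 (lift ord0 i) = x 0 i.
Proof.
have -> : lift ord0 i = rshift 1 i by apply: val_inj.
exact: row_mxEr.
Qed.

Lemma homogenizeE p (x0 : R) (x : 'rV[R]_n) : x0 != 0 ->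
  (homogenize p).@[hpoint x0 x 0] = x0 ^+ mpdeg p * p.@[(x0^-1 *: x) 0].
Proof.
move=> x0N0; rewrite [X in _ = _ * X]mevalE mulr_sumr /homogenize.
rewrite raddf_sum /= big_seq [RHS]big_seq; apply: eq_bigr => m m_supp.
have le_md : (mdeg m <= mpdeg p)%N.
  by rewrite /mpdeg -ltnS (leq_trans (msize_mdeg_lt m_supp)) ?leqSpred.
rewrite mevalZ mevalX big_ord_recl [RHS]mulrCA; congr (_ * _).
rewrite mnmE unlift_none /= hpoint0.
under eq_bigr => i _ do rewrite mnmE liftK /= hpointS.
under [in RHS]eq_bigr => i _ do rewrite mxE exprMn.
rewrite big_split /= mulrA; congr (_ * _).
rewrite prodrXr -mdegE -[in RHS](subnK le_md) exprD -mulrA -exprMn.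
by rewrite mulfV // expr1n mulr1.
Qed.

End Homogenization.

(* minimize f(x) subject to c_i(x) = 0 for i in E and c_j(x) >= 0 for j in I *)
Section Problem.
Variables (R : realType) (n : nat) (L : finType) (E I : pred L).
Variables (f : {mpoly R[n]}) (c : L -> {mpoly R[n]}).

Definition feasible : set 'rV[R]_n :=
  [set x | (forall i, E i -> (c i).@[x 0] = 0) /\
           (forall j, I j -> 0 <= (c j).@[x 0])].

Definition fmin : \bar R := ereal_inf [set (f.@[x 0])%:E | x in feasible].

Definition tKh : set 'rV[R]_n.+1 :=
  [set z | [/\ forall i, E i -> (homogenize (c i)).@[z 0] = 0,
               forall j, I j -> 0 <= (homogenize (c j)).@[z 0]
             & 0 <= z 0 ord0]].

Definition tKc : set 'rV[R]_n.+1 := tKh `&` [set z | 0 < z 0 ord0].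

Definition tK : set 'rV[R]_n.+1 :=
  tKh `&` [set z | \sum_(i < n.+1) z 0 i ^+ 2 = 1].

Definition closed_at_infinity : Prop := closure tKc = tKh.

Definition minimizer_at_infinity (x : 'rV[R]_n) : Prop :=
  let z := hpoint 0 x in
  tK z /\
  (((homogenize f).@[z 0])%:E - fmin * (z 0 ord0 ^+ mpdeg f)%:E = 0)%E.

End Problem.

(* The labels 1, ..., m2 are the ordinals 0, ..., m2 - 1 of 'I_m2. *)
Definition eq_label (m1 m2 : nat) : pred 'I_m2 := fun i => (i < m1)%N.
Definition ineq_label (m1 m2 : nat) : pred 'I_m2 := fun i => (m1 <= i)%N.
Arguments eq_label : clear implicits.
Arguments ineq_label : clear implicits.

Section ResultantDiscriminant.
Variables (R : realType) (n : nat).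
Implicit Types ps : seq {mpoly R[n]}.

Definition complexify (p : {mpoly R[n]}) : {mpoly (complex R)[n]} :=
  map_mpoly (real_complex R) p.

Definition common_zero ps (u : 'rV[complex R]_n) : Prop :=
  u <> 0 /\ forall p, p \in ps -> (complexify p).@[u 0] = 0.

(* The matrix whose columns are the gradients at u of the members of ps. *)
Definition gradients ps (u : 'rV[complex R]_n) : 'M[complex R]_(n, size ps) :=
  \matrix_(i < n, k < size ps) ((complexify ps`_k)^`M(i)).@[u 0].

(* Res(ps) = 0, for a list ps of n forms: the resultant is specified by its
   zero locus, as the condition for a nontrivial common complex zero. *)
Definition resultant_vanishes ps : Prop := exists u, common_zero ps u.

(* Delta(ps) = 0, for a list ps of at most n forms: specified likewise, by a
   nontrivial common complex zero with linearly dependent gradients. *)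
Definition discriminant_vanishes ps : Prop :=
  exists u, common_zero ps u /\ (\rank (gradients ps u) < size ps)%N.

End ResultantDiscriminant.

(* Main.v *)
(** Suppose that x is a minimizer at infinity, and let J be the set of those
    inequality labels j with c_j^(1)(x) = 0. By (i), J has at most n - m1 - 1
    elements, so by (ii) the real gradients at x of f^(1), of the c_i^(1) with
    i in E and of the c_j^(1) with j in J are linearly independent. These
    polynomials vanish at x and form a submersion there, so some y close to x
    has f^(1)(y) < 0, zero values for the others, and c_j^(1)(y) > 0 for the
    remaining inequalities. Thus (0, y) lies in the closure of the homogenized
    feasible set, and dehomogenizing nearby points with x_0 > 0 makes f
    unbounded below on K. *)

Require Import Defs.
From HB Require Import structures.
From mathcomp Require Import all_boot all_order all_algebra.
From mathcomp Require Import complex mpoly ring.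
From mathcomp Require Import boolp classical_sets functions reals.
From mathcomp Require Import constructive_ereal ereal topology normedtype.
From mathcomp Require Import sequences.

Set Implicit Arguments.
Unset Strict Implicit.
Unset Printing Implicit Defensive.

Import Order.TTheory GRing.Theory Num.Theory.
Import numFieldNormedType.Exports.

Local Open Scope ring_scope.

(* Completes the join with the normed module structure, which the library does
   not declare for matrices. *)
HB.instance Definition _ (R : realType) (m k : nat) :=
  Uniform_isComplete.Build 'M[R]_(m, k) cauchy_cvg.

(** * Max-entry norm estimates and perturbations of the identity *)

Section MatrixNorm.
Variable R : realType.

Lemma mx_norm_entry (m n : nat) (A : 'M[R]_(m, n)) i j : `|A i j| <= `|A|.
Proof.
rewrite [leRHS]/Num.norm /= mx_normrE.
exact: (le_bigmax _ (fun ij : 'I_m * 'I_n => `|A ij.1 ij.2|) (i, j)).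
Qed.

Lemma mx_norm_le (m n : nat) (A : 'M[R]_(m, n)) e :
  0 <= e -> (forall i j, `|A i j| <= e) -> `|A| <= e.
Proof.
move=> e0 Ae; rewrite [leLHS]/Num.norm /= mx_normrE.
by apply/bigmax_leP; split=> // -[i j] _; exact: Ae.
Qed.

Lemma mx_norm_mul (m n : nat) (v : 'rV[R]_m) (A : 'M[R]_(m, n)) e :
  0 <= e -> (forall i j, `|A i j| <= e) -> `|v *m A| <= m%:R * e * `|v|.
Proof.
move=> e0 Ae; apply: mx_norm_le => [|i j]; first by rewrite !mulr_ge0.
rewrite mxE (le_trans (ler_norm_sum _ _ _))//.
apply: (@le_trans _ _ (\sum_(l < m) e * `|v|)); last first.
  by rewrite sumr_const card_ord -mulrA mulr_natl.
apply: ler_sum => l _; rewrite normrM mulrC ler_pM//.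
exact: mx_norm_entry.
Qed.

(** Fixed points of [t - (G t - G 0) + y] are exactly the solutions of [G t = G 0 + y]. This map is
    a contraction of ratio 1/2 on the closed ball of radius [r], so Banach's theorem yields one. *)
Lemma near_identity_onto (k : nat) (G : 'rV[R]_k -> 'rV[R]_k) (r : R)
    (y : 'rV[R]_k) :
  0 < r ->
  (forall s t, `|s| <= r -> `|t| <= r ->
     `|(s - t) - (G s - G t)| <= 2^-1 * `|s - t|) ->
  `|y| <= 2^-1 * r -> exists2 t, `|t| <= r & G t = G 0 + y.
Proof.
move=> r0 Gid yr.
pose U : set 'rV[R]_k := [set t | `|t| <= r]%classic.
pose T t := t - (G t - G 0) + y.
have TU : {homo T : t / U t >-> U t}.
  move=> t Ut; rewrite /U/= /T; apply: le_trans (ler_normD _ _) _.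
  (* One half of [r] bounds [t - (G t - G 0)], by comparing [t] with 0; the other half bounds
     [y]. *)
  rewrite [leRHS](_ : r = 2^-1 * r + 2^-1 * r); last first.
    by rewrite -mulrDl -[2^-1]mul1r -splitr mul1r.
  apply: lerD => //; rewrite -[X in X - _]subr0.
  have := Gid t 0 Ut; rewrite normr0 subr0 => /(_ (ltW r0))/le_trans; apply.
  by rewrite ler_pM2l// invr_gt0.
pose Tf : {fun U >-> U} := mkfun_fun TU.
have Tc : is_contraction Tf.
  exists (2^-1)%:nng; split=> /=; first by rewrite invf_lt1// ltr1n.
  move=> [s t] [/= Us Ut].
  suff -> : T s - T t = (s - t) - (G s - G t) by exact: Gid.
  by apply/rowP=> i; rewrite !mxE; ring.
have Ucl : closed U.
  rewrite (_ : U = closed_ball (0 : 'rV[R]_k) r).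
    exact: closed_ball_closed.
  rewrite closed_ballE// /closed_ball_; apply/seteqP.
  by split=> t /=; rewrite sub0r normrN.
have [|t Ut tT] := banach_fixed_point Tc Ucl.
  by exists 0; rewrite /U/= normr0 ltW.
exists t => //; apply/subr0_eq; transitivity (t - T t).
  by rewrite /T; apply/rowP=> i; rewrite !mxE; ring.
by apply/eqP; rewrite subr_eq0 {1}tT.
Qed.

End MatrixNorm.

(** * Induction on polynomials and change of coefficients *)

(** Constants and variables generate the polynomial ring, so evaluation and continuity facts need
    only be checked on generators, sums and products. *)
Lemma mpoly_alg_ind (n : nat) (R : comNzRingType) (P : {mpoly R[n]} -> Prop) :
  (forall a, P a%:MP) -> (forall i, P 'X_i) ->
  (forall p q, P p -> P q -> P (p + q)) ->
  (forall p q, P p -> P q -> P (p * q)) -> forall p, P p.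
Proof.
move=> PC PX PD PM; elim/mpolyind => [|a m p _ _ Pp].
  by rewrite -mpolyC0; exact: PC.
apply/PD => //; rewrite -mul_mpolyC; apply/PM => //.
rewrite mpolyXE_id; elim/big_rec: _ => [|i q _ Pq]; first exact: (PC 1).
apply/PM => //.
elim: (m i) => [|e IHe]; first by rewrite expr0; exact: (PC 1).
by rewrite exprS; exact: PM.
Qed.

Lemma meval_map_mpoly (n : nat) (R S : comNzRingType) (phi : {rmorphism R -> S})
    (p : {mpoly R[n]}) (v : 'I_n -> R) :
  (map_mpoly phi p).@[phi \o v] = phi p.@[v].
Proof.
elim/mpoly_alg_ind: p => [a|i|p q IHp IHq|p q IHp IHq].
- by rewrite map_mpolyC !mevalC.
- by rewrite map_mpolyX !mevalXU.
- by rewrite rmorphD !mevalD rmorphD IHp IHq.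
- by rewrite rmorphM !mevalM rmorphM IHp IHq.
Qed.

Lemma mderiv_map_mpoly (n : nat) (R S : comNzRingType)
    (phi : {rmorphism R -> S}) (p : {mpoly R[n]}) i :
  (map_mpoly phi p)^`M(i) = map_mpoly phi p^`M(i).
Proof.
apply/mpolyP => m.
by rewrite mcoeff_deriv !mcoeff_map_mpoly mcoeff_deriv raddfMn.
Qed.

(** * Continuity, secants and local surjectivity of polynomial maps *)

Section PolynomialCalculus.
Variables (R : realType) (n : nat).
Implicit Types p q : {mpoly R[n]}.

Lemma meval_continuous p : continuous (fun x : 'rV[R]_n => p.@[x 0]).
Proof.
elim/mpoly_alg_ind: p => [a|i|p q cp cq|p q cp cq].
- by under eq_fun do rewrite mevalC; exact: cst_continuous.
- by under eq_fun do rewrite mevalXU; exact: coord_continuous.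
- by under eq_fun do rewrite mevalD; move=> x; exact: cvgD (cp x) (cq x).
- by under eq_fun do rewrite mevalM; move=> x; exact: cvgM (cp x) (cq x).
Qed.

(* Hadamard's decomposition of an increment, in place of the mean value
   inequality. *)
Lemma meval_secant p : exists H : 'I_n -> 'rV[R]_n * 'rV[R]_n -> R,
  [/\ forall i, continuous (H i),
      forall s t : 'rV[R]_n,
        p.@[s 0] - p.@[t 0] = \sum_i (s 0 i - t 0 i) * H i (s, t)
    & forall i (x : 'rV[R]_n), H i (x, x) = p^`M(i).@[x 0]].
Proof.
elim/mpoly_alg_ind: p => [a|j|p q [Hp [cp ep dp]] [Hq [cq eQ dq]]
                         |p q [Hp [cp ep dp]] [Hq [cq eQ dq]]].
- exists (fun _ _ => 0); split=> [i|s t|i x]; first exact: cst_continuous.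
    by rewrite !mevalC subrr big1 // => i _; rewrite mulr0.
  by rewrite mderivC meval0.
- exists (fun i _ => (i == j)%:R); split=> [i|s t|i x].
  + exact: cst_continuous.
  + rewrite !mevalXU (bigD1 j)//= eqxx mulr1 big1 ?addr0// => i /negbTE ->.
    by rewrite mulr0.
  + rewrite mderivX mnm1E eq_sym; case: eqVneq => [->|_].
      by rewrite scale1r -[X in (X - _)%MM]add0m addmK mpolyX0 meval1.
    by rewrite scale0r meval0.
- exists (fun i st => Hp i st + Hq i st); split=> [i st|s t|i x].
  + exact: cvgD (cp i st) (cq i st).
  + rewrite !mevalD opprD addrACA ep eQ -big_split/=.
    by apply: eq_bigr => i _; rewrite mulrDr.
  + by rewrite mderivD mevalD dp dq.
(* A discrete Leibniz rule; on the diagonal it becomes the usual one. *)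
- exists (fun i (st : 'rV[R]_n * 'rV[R]_n) =>
    p.@[st.1 0] * Hq i st + q.@[st.2 0] * Hp i st).
  split=> [i st|s t|i x].
  + apply: cvgD; apply: cvgM => //; [|exact: cq| |exact: cp].
      apply: (@continuous_comp _ _ _ fst (fun x : 'rV[R]_n => p.@[x 0])).
        exact: cvg_fst.
      exact: meval_continuous.
    apply: (@continuous_comp _ _ _ snd (fun x : 'rV[R]_n => q.@[x 0])).
      exact: cvg_snd.
    exact: meval_continuous.
  + rewrite !mevalM.
    transitivity (p.@[s 0] * (q.@[s 0] - q.@[t 0]) +
                  q.@[t 0] * (p.@[s 0] - p.@[t 0])); first by ring.
    rewrite ep eQ !mulr_sumr -big_split/=; apply: eq_bigr => i _.
    by ring.
  + by rewrite mderivM mevalD !mevalM dp dq addrC [in X in X + _]mulrC.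
Qed.

(** With [B] a left inverse of the Jacobian, [t |-> g (a + t *m B)] maps R^k to itself with
    derivative the identity at 0, so [near_identity_onto] applies to it. *)
Lemma meval_submersion_onto (k : nat) (g : 'I_k -> {mpoly R[n]})
    (a : 'rV[R]_n) (U : set 'rV[R]_n) :
  \rank (\matrix_(i < n, j < k) (g j)^`M(i).@[a 0]) = k -> nbhs a U ->
  exists2 e, 0 < e & forall y : 'rV[R]_k, `|y| <= e ->
    exists2 x, U x & forall j, (g j).@[x 0] = (g j).@[a 0] + y 0 j.
Proof.
move=> rk Ua.
have /row_fullP[B BJ] : row_full (\matrix_(i < n, j < k) (g j)^`M(i).@[a 0]).
  by rewrite /row_full rk.
have [H HP] := choice (fun j => meval_secant (g j)).
(* Chosen so that [k * e0 <= 1/2], where [k] is the factor lost in [mx_norm_mul]; the [+ 1] keeps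
   [e0] positive when [k = 0]. *)
pose e0 : R := (2 * (k%:R + 1))^-1.
have e00 : 0 < e0 by rewrite invr_gt0 mulr_gt0// ltr_wpDl.
pose h (t : 'rV[R]_k) : 'rV[R]_n := a + t *m B.
pose S (st : 'rV[R]_n * 'rV[R]_n) := \matrix_(i < n, j < k) H j i st.
have h0 : h 0 = a by rewrite /h mul0mx addr0.
(* The secant coefficients, collected in [S], express the increment exactly as [s - t] times a
   matrix. *)
have hS s t : (\row_j (g j).@[h s 0]) - (\row_j (g j).@[h t 0])
    = (s - t) *m (B *m S (h s, h t)).
  apply/rowP => j; rewrite mulmxA mulmxBl !mxE; have [_ -> _] := HP j.
  by apply: eq_bigr => i _; rewrite /S !mxE; congr (_ * _); ring.
have mulBc : continuous (mulmxr B : 'rV[R]_k -> 'rV[R]_n).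
  apply: (bounded_linear_continuous (f := mulmxr B)).
  apply/bounded_funP => r; exists (k%:R * `|B| * r) => x xr.
  apply: le_trans (mx_norm_mul _ (normr_ge0 B) (mx_norm_entry _)) _.
  by rewrite ler_wpM2l// mulr_ge0.
have hc : continuous h by move=> t; exact: (cvgD (cvg_cst a) (mulBc t)).
have hfstc : continuous (fun st : 'rV[R]_k * 'rV[R]_k => h st.1).
  move=> st; apply: (@continuous_comp _ _ _ fst h); first exact: cvg_fst.
  exact: hc.
have hsndc : continuous (fun st : 'rV[R]_k * 'rV[R]_k => h st.2).
  move=> st; apply: (@continuous_comp _ _ _ snd h); first exact: cvg_snd.
  exact: hc.
(* The deviation from the identity: it vanishes at the origin because [B] inverts the Jacobian,
   hence is small nearby by continuity. *)
pose Id st := 1%:M - B *m S (h st.1, h st.2).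
have Id0 : Id (0, 0) = 0.
  rewrite /Id /= h0 (_ : S (a, a) = \matrix_(i, j) (g j)^`M(i).@[a 0]).
    by rewrite BJ subrr.
  by apply/matrixP => i j; rewrite !mxE; have [_ _ ->] := HP j.
have Idc i j : continuous (fun st => Id st i j).
  have hhc : continuous (fun st => (h st.1, h st.2)).
    by move=> st; apply: (cvg_pair (G := nbhs (h st.1)) (H := nbhs (h st.2)));
      [exact: hfstc|exact: hsndc].
  rewrite (_ : (fun st => _) = fun st => (i == j)%:R -
      \sum_l B i l * H j l (h st.1, h st.2)); last first.
    apply/funext => st; rewrite /Id !mxE; congr (_ - _).
    by apply: eq_bigr => l _; rewrite mxE.
  have Bc l : continuous (fun st => B i l * H j l (h st.1, h st.2)).
    move=> st; apply: (cvgM (cvg_cst (B i l))).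
    apply: (@continuous_comp _ _ _ (fun st => (h st.1, h st.2)) (H j l)).
      exact: hhc.
    by have [Hc _ _] := HP j; exact: Hc.
  move=> st; apply: (cvgB (cvg_cst _)).
  apply: (continuous_big (op := +%R)) => [|l _]; first exact: add_continuous.
  exact: Bc.
pose o : 'rV[R]_k * 'rV[R]_k := (0, 0).
have nearId : \forall st \near nbhs o,
    U (h st.1) /\ forall i j, `|Id st i j| <= e0.
  apply: filterI; first by apply: (hfstc o); rewrite /= h0.
  apply: (@filter_forall _ _ _ (nbhs o) (nbhs_filter o)) => i.
  apply: (@filter_forall _ _ _ (nbhs o) (nbhs_filter o)) => j.
  have := Idc i j o; rewrite /continuous_at Id0 mxE => /cvgr0_norm_le; exact.
have [r /= r0 rP] : exists2 r : R, 0 < r & forall s t : 'rV[R]_k,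
    `|s| <= r -> `|t| <= r ->
    U (h s) /\ forall i j, `|Id (s, t) i j| <= e0.
  case: nearId => -[A A'] /= [A0 A'0] AA'.
  have /nbhs_ballP[r /= r0 rA] : nbhs (0 : 'rV[R]_k) (A `&` A')%classic.
    exact: filterI.
  (* Halving the radius puts a closed ball inside the open one. *)
  have r20 : 0 < r / 2 by rewrite divr_gt0.
  exists (r / 2) => // s t sr tr.
  have lt_r (u : 'rV[R]_k) : `|u| <= r / 2 -> ball 0 r u.
    rewrite -ball_normE /= sub0r normrN => /le_lt_trans; apply.
    by rewrite ltr_pdivrMr// ltr_pMr// ltr1n.
  by apply: (AA' (s, t)); split; [have [] := rA _ (lt_r _ sr)|
                                  have [] := rA _ (lt_r _ tr)].
exists (2^-1 * r); first by rewrite mulr_gt0// invr_gt0.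
move=> y yr; pose G t : 'rV[R]_k := \row_j (g j).@[h t 0].
have Gid s t : `|s| <= r -> `|t| <= r ->
    `|(s - t) - (G s - G t)| <= 2^-1 * `|s - t|.
  move=> sr tr; rewrite hS -{1}[s - t]mulmx1 -mulmxBr -/(Id (s, t)).
  have [_ Ie0] := rP _ _ sr tr.
  apply: le_trans (mx_norm_mul _ (ltW e00) Ie0) _; rewrite ler_wpM2r//.
  rewrite /e0 invfM mulrCA -[leRHS]mulr1 ler_pM2l ?invr_gt0//.
  by rewrite ler_pdivrMr ?ltr_wpDl// mul1r lerDl.
have [t tr Gt] := near_identity_onto r0 Gid yr.
exists (h t); first by have [] := rP _ _ tr tr.
by move=> j; move/rowP: Gt => /(_ j); rewrite !mxE h0.
Qed.

End PolynomialCalculus.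

(** * Behaviour of the problem on the hyperplane at infinity *)

Section Infinity.
Variables (R : realType) (n : nat) (L : finType) (E I : pred L).
Variables (f : {mpoly R[n]}) (c : L -> {mpoly R[n]}).

(** The exponent of x_0 in a homogenized monomial is its degree defect, so at x_0 = 0 only the
    monomials of top degree survive. *)
Lemma homogenize_hpoint0 (p : {mpoly R[n]}) (x : 'rV[R]_n) :
  (homogenize p).@[hpoint 0 x 0] = (topform p).@[x 0].
Proof.
rewrite /homogenize /topform pihomogE !raddf_sum /= [RHS]big_mkcond /=.
rewrite big_seq [RHS]big_seq; apply: eq_bigr => m m_supp.
rewrite !mevalZ !mevalX big_ord_recl mnmE unlift_none /= hpoint0.
under eq_bigr => i _ do rewrite mnmE liftK /= hpointS.
case: eqVneq => [->|ne_md]; first by rewrite subnn expr0 mul1r.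
have lt_md : (mdeg m < mpdeg p)%N.
  rewrite ltn_neqAle ne_md /mpdeg -ltnS (leq_trans (msize_mdeg_lt m_supp))//.
  exact: leqSpred.
by rewrite expr0n subn_eq0 leqNgt lt_md mul0r mulr0.
Qed.

Lemma hpoint_split (w : 'rV[R]_n.+1) :
  w = hpoint (w 0 ord0) (rsubmx (w : 'rV_(1 + n))).
Proof.
apply/rowP => i; case: (unliftP ord0 i) => [j|] ->; last by rewrite hpoint0.
by rewrite hpointS !mxE; congr (w _ _); apply: val_inj.
Qed.

Lemma tKc_feasible (w : 'rV[R]_n.+1) : tKc E I c w ->
  feasible E I c ((w 0 ord0)^-1 *: rsubmx (w : 'rV_(1 + n))).
Proof.
case=> -[wE wI _] /= w0; have wN0 : w 0 ord0 != 0 by rewrite gt_eqF.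
split=> [i /wE|j /wI]; rewrite {1}[w]hpoint_split homogenizeE//.
  by move/eqP; rewrite mulf_eq0 expf_eq0 (negbTE wN0) andbF => /eqP.
by rewrite pmulr_rge0// exprn_gt0.
Qed.

Lemma fmin_lower_bound : (-oo < fmin E I f c)%E ->
  exists M : R, forall x, feasible E I c x -> M <= f.@[x 0].
Proof.
have le_fmin x : feasible E I c x -> (fmin E I f c <= (f.@[x 0])%:E)%E.
  by move=> Kx; apply: ereal_inf_lbound; exists x.
case: (fmin E I f c) le_fmin => [r|//|//] le_fmin _.
  by exists r => x /le_fmin; rewrite lee_fin.
(* Here [fmin] is [+oo], so there is no feasible point and any bound serves. *)
by exists 0 => x /le_fmin; rewrite leye_eq.
Qed.

(* If f~(0, y) < 0 then f(x / x_0) = f~(x_0, x) / x_0 ^ deg f tends to -oo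
   along points (x_0, x) of tKc converging to (0, y). *)
Lemma topform_ge0_at_infinity (y : 'rV[R]_n) :
  closed_at_infinity E I c -> (-oo < fmin E I f c)%E -> (1 <= mpdeg f)%N ->
  tKh E I c (hpoint 0 y) -> 0 <= (topform f).@[y 0].
Proof.
move=> <- /fmin_lower_bound[M fM] d1 Ky; rewrite leNgt; apply/negP => f_lt0.
(* On [tKc] this equals x_0^d (f(x/x_0) - M), which is nonnegative, whereas at (0, y) it is negative
   since d >= 1. Continuity and density of [tKc] in [tKh] give the contradiction. *)
pose h := homogenize f - M *: 'X_ord0 ^+ mpdeg f.
have hE (w : 'rV_n.+1) :
    h.@[w 0] = (homogenize f).@[w 0] - M * w 0 ord0 ^+ mpdeg f.
  by rewrite mevalB mevalZ rmorphXn /= mevalXU.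
have h_lt0 : h.@[hpoint 0 y 0] < 0.
  by rewrite hE homogenize_hpoint0 hpoint0 expr0n eqn0Ngt d1 mulr0 subr0.
have near_lt0 : nbhs (hpoint 0 y) [set w | h.@[w 0] < 0]%classic.
  exact: (meval_continuous (lt_nbhsl h_lt0)).
have [w [Kw]] := Ky _ near_lt0; rewrite /= ltNge => /negP; apply.
have w0 : 0 < w 0 ord0 by case: Kw.
rewrite hE {1}[w]hpoint_split homogenizeE ?gt_eqF// mulrC -mulrBl.
rewrite mulr_ge0 ?exprn_ge0 ?(ltW w0)// subr_ge0.
exact/fM/tKc_feasible.
Qed.

End Infinity.

(** * Real consequences of the complex nonvanishing conditions *)

Section RealPoints.
Variables (R : realType) (n : nat).
Implicit Types (p : {mpoly R[n]}) (x : 'rV[R]_n).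

Let cx x : 'rV[complex R]_n := map_mx (real_complex R) x.

Lemma meval_complexify p x :
  (complexify p).@[cx x 0] = real_complex R p.@[x 0].
Proof. by rewrite -meval_map_mpoly; apply: meval_eq => i; rewrite mxE. Qed.

Lemma common_zero_real (ps : seq {mpoly R[n]}) x :
  x != 0 -> (forall p, p \in ps -> p.@[x 0] = 0) -> common_zero ps (cx x).
Proof.
move=> xN0 psx; split=> [/eqP|p /psx px].
  by rewrite map_mx_eq0 (negbTE xN0).
by rewrite meval_complexify px rmorph0.
Qed.

(** A real zero is also a complex one, and the rank of a real matrix is unchanged over the complex
    numbers. *)
Lemma rank_real_gradients (ps : seq {mpoly R[n]}) x :
  ~ discriminant_vanishes ps -> x != 0 ->
  (forall p, p \in ps -> p.@[x 0] = 0) ->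
  \rank (\matrix_(i < n, k < size ps) (ps`_k)^`M(i).@[x 0]) = size ps.
Proof.
move=> disc xN0 psx; apply/eqP; rewrite eqn_leq rank_leq_col leqNgt.
apply/negP => rk; apply: disc; exists (cx x).
split; first exact: common_zero_real.
rewrite (_ : gradients ps _ = map_mx (real_complex R)
  (\matrix_(i < n, k < size ps) (ps`_k)^`M(i).@[x 0])) ?mxrank_map//.
by apply/matrixP => i k; rewrite !mxE mderiv_map_mpoly meval_complexify.
Qed.

End RealPoints.

(** * Exclusion of minimizers at infinity *)

Theorem theorem4p5 (R : realType) (n m1 m2 d0 : nat) (d_ : 'I_m2 -> nat)
    (f : {mpoly R[n]}) (c : 'I_m2 -> {mpoly R[n]}) :
  (m1 <= m2)%N -> (m1 < n)%N ->
  (mpdeg f <= d0)%N -> (forall i, (mpdeg (c i) <= d_ i)%N) ->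
  (-oo < fmin (eq_label m1 m2) (ineq_label m1 m2) f c)%E ->
  (1 <= mpdeg f)%N ->
  closed_at_infinity (eq_label m1 m2) (ineq_label m1 m2) c ->
  (forall js : seq 'I_m2,
     all (ineq_label m1 m2) js -> sorted ltn [seq val j | j <- js] ->
     size js = (n - m1)%N ->
     ~ resultant_vanishes
         ([seq topform (c i) | i <- enum (eq_label m1 m2)] ++
          [seq topform (c j) | j <- js])) ->
  (forall js : seq 'I_m2,
     all (ineq_label m1 m2) js -> sorted ltn [seq val j | j <- js] ->
     (size js <= n - m1 - 1)%N ->
     ~ discriminant_vanishes
         (topform f :: [seq topform (c i) | i <- enum (eq_label m1 m2)] ++
          [seq topform (c j) | j <- js])) ->
  ~ exists x : 'rV[R]_n,
      minimizer_at_infinity (eq_label m1 m2) (ineq_label m1 m2) f c x.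
Proof.
move=> _ m1n _ _ fm d1 Kcl res disc [x [[[xE xI _] /= x1] fx]].
set E := eq_label m1 m2 in fm Kcl res disc xE fx *.
set I := ineq_label m1 m2 in fm Kcl res disc xI fx *.
have xN0 : x != 0.
  apply/eqP => x0; move: x1; rewrite big_ord_recl hpoint0 big1 => [|i _].
    by rewrite expr0n addr0 => /eqP; rewrite eq_sym oner_eq0.
  by rewrite hpointS x0 mxE expr0n.
have f0 : (topform f).@[x 0] = 0.
  (* As d >= 1, the factor 0^d is 0, and its product with [fmin] is 0 even when [fmin] is [+oo]. *)
  move: fx; rewrite hpoint0 expr0n eqn0Ngt d1 mule0 sube0 => -[].
  by rewrite homogenize_hpoint0.
have cE0 i : E i -> (topform (c i)).@[x 0] = 0.
  by move=> /xE; rewrite homogenize_hpoint0.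
have cI0 j : I j -> 0 <= (topform (c j)).@[x 0].
  by move=> /xI; rewrite homogenize_hpoint0.
(* Filtering the enumeration keeps the active labels increasing, as (i) and (ii) require of index
   lists. *)
pose J := [seq j <- enum 'I_m2 | I j && ((topform (c j)).@[x 0] == 0)].
have JP j : j \in J = I j && ((topform (c j)).@[x 0] == 0).
  by rewrite mem_filter mem_enum andbT.
have subJ js : subseq js J -> all I js /\ sorted ltn [seq val j | j <- js].
  move=> jsJ; split.
    by apply/allP => j /(mem_subseq jsJ); rewrite JP => /andP[].
  apply: (subseq_sorted ltn_trans (map_subseq val (subseq_trans jsJ _))).
    exact: filter_subseq.
  by rewrite val_enum_ord iota_ltn_sorted.
pose cs js :=
  [seq topform (c i) | i <- enum E] ++ [seq topform (c j) | j <- js].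
have cs0 js : subseq js J -> forall p, p \in cs js -> p.@[x 0] = 0.
  move=> jsJ p; rewrite mem_cat => /orP[] /mapP[j jP ->].
    by apply: cE0; rewrite mem_enum in jP.
  by move/(mem_subseq jsJ): jP; rewrite JP => /andP[_ /eqP].
have sJ : (size J <= n - m1 - 1)%N.
  rewrite leqNgt; apply/negP => ltJ.
  (* The first [n - m1] active labels would have [x] as a common zero, against (i). *)
  have jsJ : subseq (take (n - m1) J) J by exact: take_subseq.
  have [aI sI] := subJ _ jsJ; apply: (res _ aI sI).
    rewrite size_take_min; apply/minn_idPl.
    by rewrite subn1 prednK ?subn_gt0 in ltJ.
  exists (map_mx (real_complex R) x).
  by apply: common_zero_real => // p /(cs0 _ jsJ).
have [aI sI] := subJ _ (subseq_refl J).
pose ps := topform f :: cs J.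
have ps0 p : p \in ps -> p.@[x 0] = 0.
  by rewrite inE => /predU1P[->//|]; exact: cs0.
have rk := rank_real_gradients (disc _ aI sI sJ) xN0 ps0.
(* Staying in [U] keeps the inactive inequalities strict. *)
pose U := [set y : 'rV[R]_n | forall j, 0 < (topform (c j)).@[x 0] ->
                          0 < (topform (c j)).@[y 0]]%classic.
have Ux : nbhs x U.
  apply: (@filter_forall _ _ _ (nbhs x) (nbhs_filter x)) => j.
  have [cj|_] := boolP (0 < _); last by apply: nearW.
  have near_pos :
      nbhs x [set y : 'rV[R]_n | 0 < (topform (c j)).@[y 0]]%classic.
    exact: (meval_continuous (lt_nbhsr cj)).
  by apply: filterS near_pos => y cy _.
have [e e0 onto] := meval_submersion_onto rk Ux.
(* Index 0 of [ps] is [topform f], the only form whose value is to change. *)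
pose v : 'rV[R]_(size ps) := \row_k (if val k == 0%N then - e else 0).
have ve : `|v| <= e.
  apply: mx_norm_le => [|i k]; first exact: ltW.
  by rewrite mxE; case: ifP; rewrite ?normrN ?normr0 ?gtr0_norm// ltW.
have [y Uy yv] := onto v ve.
have fy : (topform f).@[y 0] < 0.
  by have := yv ord0; rewrite mxE /= f0 add0r => ->; rewrite oppr_lt0.
have cy p : p \in cs J -> p.@[y 0] = 0.
  move=> pJ; have lt_p : ((index p (cs J)).+1 < size ps)%N.
    by rewrite ltnS index_mem.
  by have := yv (Ordinal lt_p); rewrite mxE /= nth_index// addr0 (cs0 J).
have Ky : tKh E I c (hpoint 0 y).
  split=> [i Ei|j Ij|]; last by rewrite hpoint0.
    rewrite homogenize_hpoint0 cy// mem_cat.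
    by apply/orP; left; apply: map_f; rewrite mem_enum.
  rewrite homogenize_hpoint0; have := cI0 j Ij.
  rewrite le_eqVlt => /predU1P[cj0|/Uy/ltW//].
  rewrite cy// mem_cat; apply/orP; right; apply: map_f.
  by rewrite JP Ij -cj0 eqxx.
by have := topform_ge0_at_infinity Kcl fm d1 Ky; rewrite leNgt fy.
Qed.
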